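(* Let $0<\alpha<\beta$, and put $b=\frac{\beta+\alpha}{\beta-\alpha}$ and $c=b+\frac{2}{\beta-\alpha}$. (i) For every integer $n\ge 1$ the exceptional zero $\widehat{x}_{n,n}^{(\alpha,\beta)}$ of the $X_1$-Jacobi polynomial $\widehat{P}_n^{(\alpha,\beta)}$ belongs to $(b,c]$, and the sequence $\{\widehat{x}_{n,n}^{(\alpha,\beta)}\}_{n=1}^{\infty}$ is strictly decreasing, that is, $$b<\ldots<\widehat{x}_{n,n}^{(\alpha,\beta)}<\ldots<\widehat{x}_{2,2}^{(\alpha,\beta)}<\widehat{x}_{1,1}^{(\alpha,\beta)}=c.$$ Moreover, for every $n\ge 1$, $$b<\widehat{x}_{n,n}^{(\alpha,\beta)}\le \frac{2n+\alpha+\beta}{2n-2+\alpha+\beta}\, b.$$ (ii) For every $\alpha>0$ and every integer $n\ge 1$ the exceptional zero $\widehat{x}_{n,1}^{(\alpha)}$ of the $X_1$-Laguerre polynomial $\widehat{L}_n^{(\alpha)}$ belongs to $[-\alpha-1,-\alpha)$, and the sequence $\{\widehat{x}_{n,1}^{(\alpha)}\}_{n=1}^{\infty}$ is strictly increasing: $$-(\alpha+1)=\widehat{x}_{1,1}^{(\alpha)}<\ldots<\widehat{x}_{n-1,1}^{(\alpha)}<\widehat{x}_{n,1}^{(\alpha)}<\ldots<-\alpha.$$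
   Context: $X_1$-Jacobi polynomials: for $\alpha,\beta>-1$ of the same sign with $\alpha\ne\beta$, set $a=\frac12(\beta-\alpha)$, $b=\frac{\beta+\alpha}{\beta-\alpha}$, $c=b+\frac1a$. The sequence $\{\widehat{P}_n^{(\alpha,\beta)}(x)\}_{n=1}^\infty$ (with $\deg \widehat{P}_n^{(\alpha,\beta)}=n$) is obtained by Gram-Schmidt orthogonalization of the polynomials $x-c,\ (x-b)^2,\ (x-b)^3,\ldots$ with respect to the inner product $$\langle P,Q\rangle_{\alpha,\beta}=\int_{-1}^{1}P(x)Q(x)\frac{(1-x)^\alpha(1+x)^\beta}{(x-b)^2}\,dx.$$ The normalization (nonzero constant factors) is irrelevant for the zeros. The zeros of $\widehat{P}_n^{(\alpha,\beta)}$ are denoted $\widehat{x}_{n,k}^{(\alpha,\beta)}$, $k=1,\ldots,n$, in increasing order. It is known that they are real, that $n-1$ of them are distinct and lie in $(-1,1)$ (the regular zeros), and that the remaining one (the exceptional zero) lies outside; for $0<\alpha<\beta$ one has $b>1$ and the exceptional zero is the largest one, $\widehat{x}_{n,n}^{(\alpha,\beta)}\in(b,\infty)$. $X_1$-Laguerre polynomials: for $\alpha>0$, the sequence $\{\widehat{L}_n^{(\alpha)}(x)\}_{n=1}^\infty$ (with $\deg\widehat{L}_n^{(\alpha)}=n$) is obtained by Gram-Schmidt orthogonalization of the polynomials $x+\alpha+1,\ (x+\alpha)^2,\ (x+\alpha)^3,\ldots$ with respect to the inner product $$\langle P,Q\rangle_\alpha=\int_0^\infty P(x)Q(x)\frac{e^{-x}x^\alpha}{(x+\alpha)^2}\,dx.$$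 The zeros of $\widehat{L}_n^{(\alpha)}$ are denoted $\widehat{x}_{n,k}^{(\alpha)}$, $k=1,\ldots,n$, in increasing order. It is known that they are real, that $n-1$ of them are distinct and lie in $(0,\infty)$ (the regular zeros), and that the remaining one (the exceptional zero), $\widehat{x}_{n,1}^{(\alpha)}$, lies in $(-\infty,-\alpha)$. *)

(* Defs.v *)
From HB Require Import structures.
From mathcomp Require Import all_boot all_order all_algebra.
From mathcomp Require Import polyrcf.
From mathcomp Require Import all_classical all_reals all_analysis.

Set Implicit Arguments.
Unset Strict Implicit.
Unset Printing Implicit Defensive.

Import Order.TTheory GRing.Theory Num.Theory.
Import numFieldNormedType.Exports.
Local Open Scope classical_set_scope.
Local Open Scope ring_scope.

(* Unnormalized Gram-Schmidt orthogonalization of v 1, v 2, v 3, ... for the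
   bilinear form ip; the value v 0 is never used. *)
Fixpoint gram_schmidt_seq (R : realType) (ip : {poly R} -> {poly R} -> R)
    (v : nat -> {poly R}) (n : nat) : seq {poly R} :=
  if n is m.+1 then
    let s := gram_schmidt_seq ip v m in
    rcons s (v m.+1 - \sum_(e <- s) (ip (v m.+1) e / ip e e) *: e)
  else [::].

Definition gram_schmidt (R : realType) (ip : {poly R} -> {poly R} -> R)
    (v : nat -> {poly R}) (n : nat) : {poly R} :=
  last 0 (gram_schmidt_seq ip v n).

Lemma gram_schmidt_seqE (R : realType) (ip : {poly R} -> {poly R} -> R)
    (v : nat -> {poly R}) (n : nat) :
  gram_schmidt_seq ip v n = [seq gram_schmidt ip v k | k <- iota 1 n].
Proof.
elim: n => [//|n IHn].
have -> : iota 1 n.+1 = rcons (iota 1 n) n.+1 by rewrite -cats1 -{1}(addn1 n) iotaD.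
by rewrite map_rcons -IHn /gram_schmidt /= last_rcons.
Qed.

Lemma gram_schmidtS (R : realType) (ip : {poly R} -> {poly R} -> R)
    (v : nat -> {poly R}) (n : nat) :
  gram_schmidt ip v n.+1 = v n.+1 -
    \sum_(1 <= k < n.+1)
      (ip (v n.+1) (gram_schmidt ip v k)
         / ip (gram_schmidt ip v k) (gram_schmidt ip v k))
        *: gram_schmidt ip v k.
Proof.
rewrite {1}/gram_schmidt /= last_rcons gram_schmidt_seqE big_map.
by rewrite /index_iota subn1.
Qed.

(* k-th smallest real zero of p, counted from k = 1. [rootsR] lists the
   distinct real roots in increasing order, and beyond the end of that list
   the value is 0. If p has degree n and n real zeros, all simple, this is the
   usual enumeration of its zeros for 1 <= k <= n. *)
Definition kth_zero (R : realType) (p : {poly R}) (k : nat) : R :=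
  nth 0 (rootsR p) k.-1.

Definition jacobi_b (R : realType) (alpha beta : R) : R :=
  (beta + alpha) / (beta - alpha).

Definition jacobi_c (R : realType) (alpha beta : R) : R :=
  jacobi_b alpha beta + 2 / (beta - alpha).

Definition jacobi_inner (R : realType) (alpha beta : R) (p q : {poly R}) : R :=
  \int[lebesgue_measure]_(x in `[-1, 1])
    (p.[x] * q.[x] *
      ((1 - x) `^ alpha * (1 + x) `^ beta / (x - jacobi_b alpha beta) ^+ 2)).

Definition X1_jacobi (R : realType) (alpha beta : R) : nat -> {poly R} :=
  gram_schmidt (jacobi_inner alpha beta)
    (fun n => if n == 1%N then 'X - (jacobi_c alpha beta)%:P
              else ('X - (jacobi_b alpha beta)%:P) ^+ n).

Definition laguerre_inner (R : realType) (alpha : R) (p q : {poly R}) : R :=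
  \int[lebesgue_measure]_(x in `[0, +oo[)
    (p.[x] * q.[x] * (expR (- x) * x `^ alpha / (x + alpha) ^+ 2)).

Definition X1_laguerre (R : realType) (alpha : R) : nat -> {poly R} :=
  gram_schmidt (laguerre_inner alpha)
    (fun n => if n == 1%N then 'X + (alpha + 1)%:P
              else ('X + alpha%:P) ^+ n).

(* Main.v *)
(* With a = 1 / (c - b) (a = -1, b = -alpha for Laguerre), both families are obtained by
   orthogonalization in the space E of the polynomials p with p'(b) = - a p(b). If
   x_1, ..., x_k lie in the support of the weight, then prod_i (x - x_i) * (x - t) is in
   E for exactly one t, namely t = b + 1 / (a + sum_i 1 / (b - x_i)), which lies outside
   the support; the usual sign-change argument with these test polynomials shows that
   P_n has n - 1 regular zeros, and its exceptional zero is given by the formula for t.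

   Monotonicity: the combination P_(n+1) - l P_n that vanishes at b has a double zero
   there, since it is in E, so it is (x - b)^2 q where q has all its n - 1 zeros in the
   support. At the exceptional zero of P_n this gives the sign of P_(n+1).

   Upper bound in the Jacobi case: P_n is an eigenfunction of a second-order operator
   which is symmetric on E. Comparing the coefficients of x^n in the differential
   equation yields the sum of all zeros of P_n; the arithmetic-harmonic mean inequality
   for the numbers b - x_i then bounds sum_i 1 / (b - x_i) from below by (n - 1) / b. *)

Require Import Defs.
From mathcomp Require Import all_boot all_order all_algebra.
From mathcomp Require Import polyrcf.
From mathcomp Require Import all_classical all_reals all_analysis.
From mathcomp Require Import zify ring lra.
Import Order.TTheory GRing.Theory Num.Theory.
Import numFieldNormedType.Exports.
Local Open Scope ring_scope.

Set Implicit Arguments.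
Unset Strict Implicit.
Unset Printing Implicit Defensive.

(** * Products of linear factors and roots of odd multiplicity *)

Section RootProducts.
Variable R : realType.
Implicit Types (s : seq R) (p h : {poly R}).

Definition rootprod s : {poly R} := \prod_(x <- s) ('X - x%:P).

Lemma size1_monic h : h \is monic -> (size h <= 1)%N -> h = 1.
Proof.
by move=> hm /size1_polyC hE; move: hm; rewrite hE monicE lead_coefC => /eqP ->.
Qed.

Lemma rootprod_nil : rootprod [::] = 1.
Proof. exact: big_nil. Qed.

Lemma rootprod_cons x s : rootprod (x :: s) = ('X - x%:P) * rootprod s.
Proof. exact: big_cons. Qed.

Lemma rootprod_monic s : rootprod s \is monic.
Proof. exact: monic_prod_XsubC. Qed.

Lemma size_rootprod s : size (rootprod s) = (size s).+1.
Proof. exact: size_prod_XsubC. Qed.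

Lemma root_rootprod s x : root (rootprod s) x = (x \in s).
Proof. exact: root_prod_XsubC. Qed.

Lemma logderiv_rootprod s b : b \notin s ->
  (rootprod s)^`().[b] = (rootprod s).[b] * \sum_(x <- s) (b - x)^-1.
Proof.
elim: s => [|x s IHs]; first by rewrite rootprod_nil big_nil mulr0 -polyC1 derivC horner0.
rewrite inE negb_or => /andP[bx /IHs IH].
rewrite rootprod_cons big_cons derivM hornerD !hornerM IH derivXsubC hornerC hornerXsubC.
have bx0 : b - x != 0 by rewrite subr_eq0.
by field.
Qed.

Lemma rootprod_sign s a x : (forall y, y \in s -> 0 < a * (x - y)) ->
  0 < a ^+ size s * (rootprod s).[x].
Proof.
elim: s => [|y s IHs] H; first by rewrite rootprod_nil expr0 mul1r -polyC1 hornerC.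
rewrite rootprod_cons hornerM hornerXsubC /= exprS mulrACA mulr_gt0 //.
  by apply: H; rewrite mem_head.
by apply: IHs => z zs; apply: H; rewrite inE zs orbT.
Qed.

(** Two values of opposite sign in [D] would, by the intermediate value theorem, enclose a root, and
    that root stays in [D] because intervals are convex. *)
Lemma poly_const_sign (D : interval R) p :
  (forall x, x \in D -> ~~ root p x) ->
  (forall x, x \in D -> 0 <= p.[x]) \/ (forall x, x \in D -> p.[x] <= 0).
Proof.
move=> noroot.
have [allpos|] := pselect (forall x, x \in D -> 0 <= p.[x]); first by left.
move=> /existsNP[x /not_implyP[xD /negP]]; rewrite -ltNge => px.
right=> y yD; rewrite leNgt; apply/negP => py.
have itvD u v w : u \in D -> v \in D -> u <= w <= v -> w \in D.
  by move=> uD vD uwv; have := @interval_is_interval _ D u v uD vD w uwv.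
have [xy|/ltW yx] := leP x y.
  have [|z zxy] := poly_ivt xy (p := p); first by rewrite !ltW.
  by apply/negP/noroot/(itvD x y).
have [|z zxy] := poly_ivt yx (p := - p).
  by rewrite !hornerN oppr_le0 oppr_ge0 !ltW.
by rewrite rootN; apply/negP/noroot/(itvD y x).
Qed.

(** Roots in [D] are split off one at a time, by induction on the degree. A root met for the second
    time is removed from [s] and the resulting square goes into [h], so [s] collects the roots of
    odd multiplicity. *)
Lemma odd_roots_factor (D : interval R) p : p != 0 ->
  exists s h, [/\ uniq s, {subset s <= D}, p = rootprod s * h
    & (forall x, x \in D -> 0 <= h.[x]) \/ (forall x, x \in D -> h.[x] <= 0)].
Proof.
have [n] := ubnP (size p); elim: n p => // n IHn p pn p0.
have [[x [xD px]]|noroot] := pselect (exists x, x \in D /\ root p x); last first.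
  exists [::], p; rewrite rootprod_nil mul1r; split => //.
  by apply: poly_const_sign => x xD; apply/negP => px; apply: noroot; exists x.
have /factor_theorem[q pq] := px.
have q0 : q != 0 by apply: contraNneq p0 => q0; rewrite pq q0 mul0r.
have [|s [h [us sD qE hsign]]] := IHn q _ q0.
  by move: pn; rewrite pq size_Mmonic ?monicXsubC // size_XsubC addn2.
have [xs|xs] := boolP (x \in s); last first.
  exists (x :: s), h; split => //=; first by rewrite xs.
    by move=> y; rewrite inE => /predU1P[->|/sD].
  by rewrite rootprod_cons pq qE mulrAC -mulrA mulrCA mulrA.
exists (rem x s), (h * ('X - x%:P) ^+ 2); split.
- exact: rem_uniq.
- by move=> y /mem_rem/sD.
- rewrite pq qE; have -> : rootprod s = rootprod (x :: rem x s).
    by apply: perm_big; apply: perm_to_rem.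
  by rewrite rootprod_cons; ring.
- by case: hsign => H; [left|right] => y yD; rewrite hornerM horner_exp;
    [apply: mulr_ge0|apply: mulr_le0_ge0]; rewrite ?sqr_ge0 // H.
Qed.

End RootProducts.

(** * Gram-Schmidt in the space of exceptional polynomials, for an abstract positive functional *)

Section ExceptionalOrthogonality.
Variables (R : realType) (a b : R).
Implicit Types (s : seq R) (p : {poly R}).

Definition exceptional p := p^`().[b] = - a * p.[b].

Lemma exceptionalD p q : exceptional p -> exceptional q -> exceptional (p + q).
Proof. by rewrite /exceptional derivD !hornerD mulrDr => -> ->. Qed.

Lemma exceptionalZ k p : exceptional p -> exceptional (k *: p).
Proof. by rewrite /exceptional derivZ !hornerZ mulrCA => ->. Qed.

Lemma exceptionalB p q : exceptional p -> exceptional q -> exceptional (p - q).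
Proof. by rewrite /exceptional derivB !hornerD !hornerN mulrBr => -> ->. Qed.

Lemma exceptional_sum (I : Type) (r : seq I) (F : I -> {poly R}) :
  (forall i, exceptional (F i)) -> exceptional (\sum_(i <- r) F i).
Proof.
move=> HF; elim/big_ind: _ => //; last exact: exceptionalD.
by rewrite /exceptional deriv0 !horner0 mulr0.
Qed.

Definition recip_sum s : R := \sum_(x <- s) (b - x)^-1.

Lemma exceptional_XsubC t : (t - b) * a = 1 -> exceptional ('X - t%:P).
Proof. by move=> H; rewrite /exceptional derivXsubC hornerC hornerXsubC; lra. Qed.

Lemma exceptional_XsubC_exp n : (1 < n)%N -> exceptional (('X - b%:P) ^+ n).
Proof.
case: n => [|[|n]] // _; rewrite /exceptional deriv_exp /= derivXsubC mul1r.
by rewrite hornerMn !horner_exp hornerXsubC subrr !expr0n /= mul0rn mulr0.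
Qed.

Definition exc_root s : R := b + (a + recip_sum s)^-1.

Variable D : interval R.
Hypothesis a0 : a != 0.
(** The sign of [a] tells on which side of [D] the point [b] lies. Inequalities multiplied by [a]
    cover the Jacobi case, [b] to the right, and the Laguerre case, [b] to the left, together. *)
Hypothesis Db : forall x, x \in D -> 0 < a * (b - x).

Lemma b_notin s : {subset s <= D} -> b \notin s.
Proof.
by move=> sD; apply/negP => /sD /Db; rewrite subrr mulr0 ltxx.
Qed.

Lemma recip_gt0 x : x \in D -> 0 < a * (b - x)^-1.
Proof.
move=> /Db H; have H0 : b - x != 0 by apply: contraTneq H => ->; rewrite mulr0 ltxx.
have -> : a * (b - x)^-1 = (a * (b - x)) * ((b - x)^-1) ^+ 2 by field.
by rewrite mulr_gt0 // exprn_even_gt0 //= invr_eq0.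
Qed.

Lemma recip_sum_ge0 s : {subset s <= D} -> 0 <= a * recip_sum s.
Proof.
move=> sD; rewrite /recip_sum mulr_sumr big_seq; apply: sumr_ge0 => x /sD.
by move=> /recip_gt0/ltW.
Qed.

Lemma recip_shift_gt0 s : {subset s <= D} -> 0 < a * (a + recip_sum s).
Proof.
move=> sD; rewrite mulrDr ltr_pwDl ?recip_sum_ge0 //.
by rewrite -expr2 exprn_even_gt0.
Qed.

Lemma recip_shift_neq0 s : {subset s <= D} -> a + recip_sum s != 0.
Proof.
move=> /recip_shift_gt0; by apply: contraTneq => ->; rewrite mulr0 ltxx.
Qed.

Lemma exc_root_gt s : {subset s <= D} -> 0 < a * (exc_root s - b).
Proof.
move=> sD; have H := recip_shift_gt0 sD; have H0 := recip_shift_neq0 sD.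
rewrite /exc_root addrAC subrr add0r.
have -> : a * (a + recip_sum s)^-1 =
  (a * (a + recip_sum s)) * ((a + recip_sum s)^-1) ^+ 2 by field.
by rewrite mulr_gt0 // exprn_even_gt0 //= invr_eq0.
Qed.

(** The reciprocals in the sum all have the sign of [a], so adding them to [a] can only increase its
    absolute value. *)
Lemma exc_root_le s : {subset s <= D} -> a * (exc_root s - b) <= 1.
Proof.
move=> sD; have H := recip_shift_gt0 sD; have H0 := recip_shift_neq0 sD.
have S0 := recip_sum_ge0 sD.
rewrite /exc_root addrAC subrr add0r.
have -> : a * (a + recip_sum s)^-1 = (a * a) / (a * (a + recip_sum s)).
  by field; rewrite H0 a0.
by rewrite ler_pdivrMr // mul1r mulrDr lerDl.
Qed.

(** Divided by the nonzero value of [rootprod s] at [b], the condition at [b] becomes (t - b) (a +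
    S) = 1 with S the reciprocal sum, which is solvable because a + S is nonzero. *)
Lemma exceptional_rootprodM s t : {subset s <= D} ->
  exceptional (rootprod s * ('X - t%:P)) <-> t = exc_root s.
Proof.
move=> sD; have bs := b_notin sD; have H0 := recip_shift_neq0 sD.
rewrite /exceptional derivM hornerD !hornerM derivXsubC hornerXsubC hornerC.
rewrite logderiv_rootprod // -/(recip_sum s) /exc_root.
have q0 : (rootprod s).[b] != 0 by rewrite -rootE root_rootprod.
split=> [E|->]; last by field.
apply: (mulIf H0); apply: (mulfI q0).
rewrite mulrDl mulVf //; move: E.
set q := (rootprod s).[b]; set S := recip_sum s => E.
apply/eqP; rewrite -subr_eq0; apply/eqP.
transitivity (- (q * S * (b - t) + q * 1 - (- a * (q * (b - t))))); first by ring.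
by rewrite E subrr oppr0.
Qed.

(** The logarithmic derivative at [b] is the reciprocal sum, which never has the sign of [- a]. This
    forces at least one root of each orthogonal polynomial out of [s]. *)
Lemma exceptional_rootprod s : {subset s <= D} -> ~ exceptional (rootprod s).
Proof.
move=> sD; have bs := b_notin sD.
rewrite /exceptional logderiv_rootprod // -/(recip_sum s) mulrC => E.
have q0 : (rootprod s).[b] != 0 by rewrite -rootE root_rootprod.
by move: (recip_shift_neq0 sD); rewrite (mulIf q0 E) subrr eqxx.
Qed.

Variable L : {poly R} -> R.
Hypothesis L_linear : forall k p q, L (k *: p + q) = k * L p + L q.
Hypothesis L_gt0 : forall g, g != 0 -> (forall x, x \in D -> 0 <= g.[x]) -> 0 < L g.

Lemma functional0 : L 0 = 0.
Proof. by have := L_linear (-1) 0 0; rewrite scaler0 addr0 mulN1r addNr. Qed.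

Lemma functionalZ k p : L (k *: p) = k * L p.
Proof. by have := L_linear k p 0; rewrite functional0 !addr0. Qed.

Lemma functionalD p q : L (p + q) = L p + L q.
Proof. by have := L_linear 1 p q; rewrite scale1r mul1r. Qed.

Lemma functional_sum (I : Type) (r : seq I) (F : I -> {poly R}) :
  L (\sum_(i <- r) F i) = \sum_(i <- r) L (F i).
Proof.
by elim: r => [|i r IHr]; rewrite ?big_nil ?functional0 // !big_cons functionalD IHr.
Qed.

Lemma functional_sqr_gt0 p : p != 0 -> 0 < L (p * p).
Proof.
move=> p0; apply: L_gt0 => [|x _]; first by rewrite mulf_neq0.
by rewrite hornerM -expr2 sqr_ge0.
Qed.

(** As [size] is the degree plus one, the test polynomials have degree less than [n]. *)
Definition orthogonal_below n p :=
  forall r, exceptional r -> (size r <= n)%N -> L (p * r) = 0.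

(* Otherwise the product of p with rootprod s * ('X - t), for the unique t making
   the latter exceptional, would be of constant sign on D. *)
Lemma orthogonal_below_roots n s p h : p != 0 -> {subset s <= D} ->
  p = rootprod s * h ->
  (forall x, x \in D -> 0 <= h.[x]) \/ (forall x, x \in D -> h.[x] <= 0) ->
  orthogonal_below n p -> (n <= (size s).+1)%N.
Proof.
move=> p0 sD pE hsign orth; rewrite leqNgt; apply/negP => sn.
set t := exc_root s.
have texc : exceptional (rootprod s * ('X - t%:P)) by apply/exceptional_rootprodM.
have tne : rootprod s * ('X - t%:P) != 0.
  by rewrite mulf_neq0 ?polyXsubC_eq0 // monic_neq0 ?rootprod_monic.
have := orth _ texc; rewrite size_Mmonic ?monicXsubC ?monic_neq0 ?rootprod_monic //.
rewrite size_rootprod size_XsubC addn2 /= => /(_ sn) L0.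
have tx x : x \in D -> 0 < a * (t - x).
  move=> xD; have -> : a * (t - x) = a * (t - b) + a * (b - x) by ring.
  by rewrite addr_gt0 ?exc_root_gt ?Db.
have prodE x : (p * (rootprod s * ('X - t%:P))).[x] =
    (rootprod s).[x] ^+ 2 * h.[x] * (x - t).
  by rewrite pE !hornerM hornerXsubC; ring.
(* The scalar [k] will be [a] or [- a], whichever makes the product nonnegative on [D]. *)
have contra k : k != 0 ->
    (forall x, x \in D -> 0 <= k * (p * (rootprod s * ('X - t%:P))).[x]) -> False.
  move=> k0 kpos.
  have := @L_gt0 (k *: (p * (rootprod s * ('X - t%:P)))).
  rewrite functionalZ L0 mulr0 ltxx => H; apply/notF/H => [|x xD].
    by rewrite scaler_eq0 negb_or k0 mulf_neq0.
  by rewrite hornerZ kpos.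
case: hsign => H.
  apply: (contra (- a)); first by rewrite oppr_eq0.
  move=> x xD; rewrite prodE.
  have -> : - a * ((rootprod s).[x] ^+ 2 * h.[x] * (x - t)) =
    (rootprod s).[x] ^+ 2 * h.[x] * (a * (t - x)) by ring.
  by apply: mulr_ge0; [rewrite mulr_ge0 ?sqr_ge0 ?H|rewrite ltW ?tx].
apply: (contra a) => // x xD; rewrite prodE.
have -> : a * ((rootprod s).[x] ^+ 2 * h.[x] * (x - t)) =
  (rootprod s).[x] ^+ 2 * - h.[x] * (a * (t - x)) by ring.
by apply: mulr_ge0; [rewrite mulr_ge0 ?sqr_ge0 ?oppr_ge0 ?H|rewrite ltW ?tx].
Qed.

Variables (ip : {poly R} -> {poly R} -> R) (v : nat -> {poly R}).
Hypothesis ipE : forall p q, ip p q = L (p * q).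
Hypothesis v_monic : forall n, (0 < n)%N -> v n \is monic.
Hypothesis size_v : forall n, (0 < n)%N -> size (v n) = n.+1.
Hypothesis v_exceptional : forall n, (0 < n)%N -> exceptional (v n).

Local Notation P := (gram_schmidt ip v).

(** The subtracted projections have lower degree, so the leading term is that of [v n]; the
    condition at [b] is linear and passes to the difference. The divisions by norms are legitimate
    since [L] is positive on nonzero squares. *)
Lemma gram_schmidt_spec n : (0 < n)%N ->
  [/\ P n \is monic, size (P n) = n.+1, exceptional (P n)
    & forall k, (0 < k < n)%N -> L (P n * P k) = 0].
Proof.
elim/ltn_ind: n => -[//|n] IHn _.
set c := fun k => (ip (v n.+1) (P k) / ip (P k) (P k)).
have PE : P n.+1 = v n.+1 - \sum_(1 <= k < n.+1) c k *: P k by exact: gram_schmidtS.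
have sz : (size (\sum_(1 <= k < n.+1) c k *: P k)%R < size (v n.+1))%N.
  rewrite size_v // ltnS; apply: (leq_trans (size_sum _ _ _)).
  apply/bigmax_leqP_seq => k; rewrite mem_index_iota => /andP[k0 kn] _.
  apply: (leq_trans (size_scale_leq _ _)).
  by have [_ -> _ _] := IHn k kn k0.
split.
- by rewrite PE monicE lead_coefDl ?size_polyN // -monicE v_monic.
- by rewrite PE size_polyDl ?size_polyN // size_v.
- rewrite PE; apply: exceptionalB; first exact: v_exceptional.
  (* Indices outside the range of the induction hypothesis are given the summand 0, which is
     exceptional. *)
  rewrite big_seq_cond big_mkcond /=; apply: exceptional_sum => k.
  case: ifP => [|_]; last by rewrite /exceptional deriv0 !horner0 mulr0.
  rewrite andbT mem_index_iota => /andP[k0 kn].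
  by apply: exceptionalZ; have [] := IHn k kn k0.
- move=> k /andP[k0 kn]; rewrite PE mulrBl -scaleN1r addrC L_linear mulN1r.
  rewrite mulr_suml functional_sum (bigD1_seq k) ?iota_uniq ?mem_index_iota ?k0 //=.
  rewrite big1_seq => [|i /andP[ik]].
    have [Pm _ _ _] := IHn k kn k0.
    rewrite addr0 -scalerAl functionalZ /c !ipE mulfVK ?addNr //.
    by rewrite gt_eqF // functional_sqr_gt0 // monic_neq0.
  rewrite mem_index_iota => /andP[i0 ilt]; rewrite -scalerAl functionalZ.
  have [ik'|ki] := ltnP k i.
    by have [_ _ _ ->] := IHn i ilt i0; rewrite ?mulr0 ?k0.
  by rewrite [P i * _]mulrC; have [_ _ _ ->] := IHn k kn k0;
     rewrite ?mulr0 // i0 ltn_neqAle ik.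
Qed.

(** The polynomials [P k] span the exceptional ones: subtracting the multiple of [P k] with the same
    leading term lowers the degree, and the descent ends at 0 because the only exceptional constant
    is 0. *)
Lemma gram_schmidt_orthogonal n : (0 < n)%N -> orthogonal_below n (P n).
Proof.
move=> n0 r; have [m] := ubnP (size r); elim: m r => // m IHm r rm rexc rn.
have [r1|r1] := leqP (size r) 1%N.
  move: rexc; rewrite [r]size1_polyC // /exceptional derivC horner0 hornerC.
  move=> /esym/eqP; rewrite mulf_eq0 oppr_eq0 (negPf a0) /= => /eqP ->.
  by rewrite mulr0 functional0.
have [k rk] : exists k, size r = k.+2 by case: (size r) r1 => [|[|k]] // _; exists k.
have [Pm Ps Pexc _] := gram_schmidt_spec (ltn0Sn k).
pose r' := r - lead_coef r *: P k.+1.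
have -> : r = lead_coef r *: P k.+1 + r' by rewrite /r' addrC subrK.
have r0 : r != 0 by rewrite -size_poly_gt0 rk.
have sr' : (size r' < size r)%N.
  rewrite rk ltnS; apply/leq_sizeP => j; rewrite leq_eqVlt => /predU1P[<-|jk].
    rewrite coefB coefZ.
    have -> : (P k.+1)`_k.+1 = 1 by move: Pm; rewrite monicE /lead_coef Ps => /eqP.
    by rewrite /lead_coef rk mulr1 subrr.
  by rewrite coefB coefZ !nth_default ?Ps ?rk ?mulr0 ?subrr.
rewrite mulrDr -scalerAr L_linear IHm.
- by have [_ _ _ ->] := gram_schmidt_spec n0;
     rewrite ?mulr0 ?addr0 //= -ltnS -rk.
- exact: leq_trans sr' _.
- by apply: exceptionalB => //; exact: exceptionalZ.
- exact: leq_trans (ltnW sr') rn.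
Qed.

(** Orthogonality gives at least n - 1 roots of odd multiplicity in [D]. The cofactor [h] is then
    constant or linear; a constant is excluded by [exceptional_rootprod], and the root of a linear
    one is forced by [exceptional_rootprodM]. *)
Lemma gram_schmidt_factor n : (0 < n)%N ->
  exists s, [/\ uniq s, {subset s <= D}, size s = n.-1
    & P n = rootprod s * ('X - (exc_root s)%:P)].
Proof.
move=> n0; have [Pm Ps Pexc _] := gram_schmidt_spec n0.
have P0 : P n != 0 by rewrite monic_neq0.
have [s [h [us sD PE hsign]]] := odd_roots_factor D P0.
have sn := orthogonal_below_roots P0 sD PE hsign (gram_schmidt_orthogonal n0).
have hm : h \is monic by rewrite -(monicMl _ (rootprod_monic s)) -PE.
have sE : (n.+1 = size s + size h)%N.
  by rewrite -Ps PE size_Mmonic ?monic_neq0 ?rootprod_monic // size_rootprod.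
have [h1|h1] := leqP (size h) 1%N.
  exfalso; apply: (exceptional_rootprod sD); move: Pexc.
  rewrite PE; suff -> : h = 1 by rewrite mulr1.
  exact: size1_monic.
have h2 : size h = 2%N by lia.
exists s; split=> //; first by lia.
have hE : h = 'X - (- h`_0)%:P.
  apply/polyP => -[|[|i]]; rewrite coefB coefX coefC ?sub0r ?opprK //=.
    by rewrite subr0; move: hm; rewrite monicE /lead_coef h2 => /eqP.
  by rewrite oppr0 nth_default // h2.
by move: Pexc; rewrite PE {1}hE exceptional_rootprodM // => <-; rewrite -hE.
Qed.

(* The combination of two consecutive polynomials that vanishes at b has a double zero
   there; the remaining factor has all its roots in D, so its sign at the exceptional
   zero of P n is known. *)
Lemma exc_root_monotone n s s' : (0 < n)%N ->
  {subset s <= D} -> size s = n.-1 -> P n = rootprod s * ('X - (exc_root s)%:P) ->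
  {subset s' <= D} -> size s' = n ->
  P n.+1 = rootprod s' * ('X - (exc_root s')%:P) ->
  0 < a * (exc_root s - exc_root s').
Proof.
move=> n0 sD sn PE sD' sn' PE'.
set t := exc_root s; set t' := exc_root s'.
have bt : b - t != 0.
  by have := exc_root_gt sD; apply: contraTneq; rewrite -/t => tb;
     rewrite -opprB tb oppr0 mulr0 ltxx.
have qb0 : (rootprod s).[b] != 0 by rewrite -rootE root_rootprod b_notin.
have Pb0 : (P n).[b] != 0 by rewrite PE hornerM hornerXsubC mulf_neq0.
pose l := (P n.+1).[b] / (P n).[b].
pose F := P n.+1 - l *: P n.
have [Pm Ps Pexc _] := gram_schmidt_spec n0.
have [Pm' Ps' Pexc' _] := gram_schmidt_spec (ltn0Sn n).
have Fexc : exceptional F by apply: exceptionalB => //; exact: exceptionalZ.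
have Fb : F.[b] = 0 by rewrite /F hornerD hornerN hornerZ /l mulfVK ?subrr.
have Fsz : (size (- (l *: P n))%R < size (P n.+1))%N.
  by rewrite size_polyN Ps' ltnS -Ps size_scale_leq.
have Fm : F \is monic by rewrite monicE lead_coefDl // -monicE.
have sF : size F = n.+2 by rewrite size_polyDl.
have [q Fq] : exists q, F = q * ('X - b%:P) ^+ 2.
  have /factor_theorem[q1 F1] : root F b by rewrite rootE Fb.
  have /factor_theorem[q2 F2] : root q1 b.
    move: Fexc; rewrite /exceptional Fb mulr0 F1 derivM hornerD !hornerM.
    by rewrite derivXsubC hornerXsubC hornerC subrr mulr0 add0r mulr1 rootE => ->.
  by exists q2; rewrite F1 F2 -mulrA -expr2.
have qm : q \is monic.
  by rewrite -(monicMr _ (monic_exp 2 (monicXsubC b))) -Fq.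
have sq : size q = n.
  move: sF; rewrite Fq size_Mmonic ?monic_neq0 ?monic_exp ?monicXsubC //.
  by rewrite size_exp_XsubC addn3 /= => -[].
(* The factor (x - b)^2 does not affect signs, so the orthogonality of [F] yields n - 1 roots of [q]
   in [D]; this is the degree of [q], whence [h] is 1. *)
have [w [h [uw wD qE hsign]]] := odd_roots_factor D (monic_neq0 qm).
have nw : (n <= (size w).+1)%N.
  apply: (@orthogonal_below_roots n w F (h * ('X - b%:P) ^+ 2)) => //.
  - exact: monic_neq0.
  - by rewrite mulrA -qE.
  - by case: hsign => H; [left|right] => y yD; rewrite hornerM horner_exp;
      [apply: mulr_ge0|apply: mulr_le0_ge0]; rewrite ?sqr_ge0 // H.
  - move=> r rexc rn; rewrite /F mulrBl -scalerAl -scaleNr addrC L_linear.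
    rewrite (gram_schmidt_orthogonal n0) // (gram_schmidt_orthogonal (ltn0Sn n)) //.
      by rewrite mulr0 addr0.
    exact: leqW.
have hm : h \is monic by rewrite -(monicMl _ (rootprod_monic w)) -qE.
have sE : (n = size w + size h)%N.
  by rewrite -sq qE size_Mmonic ?monic_neq0 ?rootprod_monic // size_rootprod.
have h1 : h = 1.
  by apply: size1_monic => //; rewrite -(leq_add2l (size w)) addn1 -sE.
have sw : size w = n.-1 by rewrite sE h1 size_poly1 addn1.
have sgn u : {subset u <= D} -> 0 < a ^+ size u * (rootprod u).[t].
  move=> uD; apply: rootprod_sign => y /uD yD.
  have -> : a * (t - y) = a * (t - b) + a * (b - y) by ring.
  by rewrite addr_gt0 ?exc_root_gt ?Db.
(* Since [P n] vanishes at [t], both sides are the value of [F] there. *)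
have key : (rootprod s').[t] * (t - t') = (rootprod w).[t] * (t - b) ^+ 2.
  have : F.[t] = (rootprod w).[t] * (t - b) ^+ 2.
    by rewrite Fq qE h1 mulr1 hornerM horner_exp hornerXsubC.
  rewrite /F hornerD hornerN hornerZ PE PE' !hornerM !hornerXsubC -/t -/t'.
  by rewrite subrr !mulr0 subr0.
have sgn1 := sgn _ sD'; have sgn2 := sgn _ wD.
(* The lists [s'] and [w] have n and n - 1 elements, so their sign normalizations differ by one
   factor [a], which is the one wanted in front of t - t'. *)
rewrite -(pmulr_rgt0 _ sgn1) sn'.
have -> : a ^+ n * (rootprod s').[t] * (a * (t - t')) =
  a ^+ 2 * (a ^+ size w * (rootprod w).[t] * (t - b) ^+ 2).
  rewrite sw; case: (n) n0 => // m _ /=; rewrite exprS -[_ * (t - b) ^+ 2]mulrA -key.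
  by ring.
apply: mulr_gt0; first by rewrite exprn_even_gt0.
apply: mulr_gt0 => //; by rewrite exprn_even_gt0 //= -opprB oppr_eq0.
Qed.

(** The sequence is kept abstract because the exceptional zero is the largest zero for Jacobi and
    the smallest for Laguerre. *)
Lemma exc_zero_sequence (x : nat -> R) :
  (forall n s, (0 < n)%N -> uniq s -> {subset s <= D} -> size s = n.-1 ->
     P n = rootprod s * ('X - (exc_root s)%:P) -> x n = exc_root s) ->
  [/\ forall n, (0 < n)%N -> 0 < a * (x n - b) /\ a * (x n - b) <= 1,
      x 1%N = b + a^-1
    & forall m n, (0 < m)%N -> (m < n)%N -> 0 < a * (x m - x n)].
Proof.
move=> xE.
have xP n : (0 < n)%N -> exists s, [/\ {subset s <= D}, size s = n.-1,
    P n = rootprod s * ('X - (exc_root s)%:P) & x n = exc_root s].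
  by move=> n0; have [s [us sD sn PE]] := gram_schmidt_factor n0; exists s; split;
    rewrite ?(xE n s).
split=> [n /xP[s [sD _ _ ->]]||m n m0].
- by rewrite exc_root_gt ?exc_root_le.
- have [s [_ /size0nil -> _ ->]] := xP 1%N isT.
  by rewrite /exc_root /recip_sum big_nil addr0.
elim: n => // n IHn; rewrite ltnS => mn.
have n0 : (0 < n)%N by exact: leq_trans mn.
have step : 0 < a * (x n - x n.+1).
  have [s [sD sn PE ->]] := xP n n0.
  have [s' [sD' sn' PE' ->]] := xP n.+1 isT.
  exact: exc_root_monotone n0 sD sn PE sD' sn' PE'.
move: mn; rewrite leq_eqVlt => /predU1P[-> //|/IHn IH].
by have := addr_gt0 IH step; rewrite -mulrDr addrA subrK.
Qed.

End ExceptionalOrthogonality.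

(** * Position of the exceptional zero among the sorted zeros *)

Section ExceptionalZero.
Variable R : realType.
Implicit Types (s : seq R) (t : R).

Lemma rootsR_rootprodM s t : uniq (t :: s) ->
  rootsR (rootprod s * ('X - t%:P)) = sort <=%R (t :: s).
Proof.
move=> us; apply: lt_sorted_eq.
- exact: sorted_roots.
- by rewrite sort_lt_sorted.
- have pne : rootprod s * ('X - t%:P) != 0.
    by rewrite mulf_neq0 ?polyXsubC_eq0 // monic_neq0 ?rootprod_monic.
  move=> x; have := roots_on_rootsR pne x; rewrite in_itv /= => <-.
  by rewrite mem_sort inE -root_rootprod rootM root_XsubC orbC.
Qed.

Lemma kth_zero_largest s t : uniq s -> (forall x, x \in s -> x < t) ->
  kth_zero (rootprod s * ('X - t%:P)) (size s).+1 = t.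
Proof.
move=> us st; have ts : t \notin s by apply/negP => /st; rewrite ltxx.
rewrite /kth_zero rootsR_rootprodM /=; last by rewrite ts.
have -> : sort <=%R (t :: s) = rcons (sort <=%R s) t.
  apply: le_sorted_eq.
  - exact: sort_le_sorted.
  - rewrite le_sorted_pairwise pairwise_rcons -le_sorted_pairwise sort_le_sorted.
    by rewrite andbT; apply/allP => x; rewrite mem_sort => /st/ltW.
  - by rewrite perm_sort perm_sym perm_rcons perm_cons perm_sort.
by rewrite nth_rcons size_sort ltnn eqxx.
Qed.

Lemma kth_zero_smallest s t : uniq s -> (forall x, x \in s -> t < x) ->
  kth_zero (rootprod s * ('X - t%:P)) 1 = t.
Proof.
move=> us st; have ts : t \notin s by apply/negP => /st; rewrite ltxx.
rewrite /kth_zero rootsR_rootprodM /=; last by rewrite ts.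
suff -> : sort <=%R (t :: s) = t :: sort <=%R s by [].
apply: le_sorted_eq.
- exact: sort_le_sorted.
- rewrite /= path_min_sorted ?sort_le_sorted //.
  by apply/allP => x; rewrite mem_sort => /st/ltW.
- by rewrite perm_sort perm_cons perm_sym perm_sort.
Qed.

End ExceptionalZero.

(** * The X1-Jacobi differential operator on coefficients and on exceptional polynomials *)

Section X1JacobiOperator.
Variables (R : realType) (a b : R).
Implicit Types p u : {poly R}.

(* (b - x) times the second-order X1-Jacobi differential operator
   T y = (x^2 - 1) y'' + 2 a (1 - b x) / (b - x) ((x - c) y' - y), c = b + 1 / a. *)
Definition X1op p : {poly R} :=
  ('X * 'X - 1%:P) * (b%:P - 'X) * p^`()^`()
  + (2 * a)%:P * (1%:P - b%:P * 'X) * (('X - (b + a^-1)%:P) * p^`() - p).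

Let hE := (hornerD, hornerN, hornerM, hornerX, hornerC).
Let dE := (derivD, derivN, derivM, derivX, derivC).

(** In this expanded form every term is a scalar times a derivative of [p] times a power of ['X], so
    coefficients can be read off. *)
Lemma X1opE p : X1op p =
  b *: (p^`()^`() * 'X^2) - p^`()^`() * 'X^3 - b *: p^`()^`() + p^`()^`() * 'X
  + (2 * a) *: (p^`() * 'X - (b + a^-1) *: p^`() - p - b *: (p^`() * 'X^2)
                + (b * (b + a^-1)) *: (p^`() * 'X) + b *: (p * 'X)).
Proof. by rewrite /X1op -!mul_polyC !polyCM !polyCD polyC1; ring. Qed.

Let cE := (coefD, coefN, coefZ, coefMXn, coefMX, coef_deriv).

Lemma size_X1op p : (1 < size p)%N -> (size (X1op p) <= (size p).+1)%N.
Proof.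
case sp: (size p) => [|[|k]] // _; apply/leq_sizeP => -[|[|[|j]]] // kj.
have z i : (k <= i)%N -> p`_i.+2 = 0 by move=> ki; rewrite nth_default // sp.
rewrite X1opE !cE /= ?subSS ?subn0 !z ?mul0rn; try lia.
by ring.
Qed.

(** For degree n = m + 2 this yields the eigenvalue (n - 1) (n + 2 a b); the minus sign is that of
    the leading coefficient of b - x. *)
Lemma X1op_coef_succ p m : (size p <= m.+3)%N -> (X1op p)`_m.+3 =
  - (m.+1%:R * (m.+2%:R + 2 * a * b)) * p`_m.+2.
Proof.
move=> sp; have z i : (m <= i)%N -> p`_i.+3 = 0.
  by move=> mi; rewrite nth_default // (leq_trans sp).
rewrite X1opE !cE /= ?subSS ?subn0 !z; try lia.
by rewrite !mul0rn; ring.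
Qed.

Lemma X1op_coef p m : (size p <= m.+3)%N -> (X1op p)`_m.+2 =
  (b * m.+2%:R * m.+1%:R + 2 * a * (m.+1%:R + b * (b + a^-1) * m.+2%:R)) * p`_m.+2
  - (m.+1%:R * m%:R + 2 * a * b * m%:R) * p`_m.+1.
Proof.
move=> sp; have p3 : p`_m.+3 = 0 by rewrite nth_default.
have p4 : p`_m.+4 = 0 by rewrite nth_default // (leq_trans sp).
(* For m = 0 the term with ['X^3] does not reach the coefficient of index 2. *)
case: m sp p3 p4 => [|m] sp p3 p4; rewrite X1opE !cE /= ?subSS ?subn0 p3 p4 !mul0rn.
  by ring.
by ring.
Qed.

Hypothesis a0 : a != 0.

(** The condition at [b] makes [X1op p] vanish there, which gives the quotient [u]. The first and
    second derivatives of the product at [b] determine u(b) and u'(b), and the third derivative of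
    [p] cancels. *)
Lemma X1op_exceptional p : exceptional a b p ->
  exists u, exceptional a b u /\ X1op p = (b%:P - 'X) * u.
Proof.
rewrite /exceptional => pexc.
have [u uE] : exists u, X1op p = (b%:P - 'X) * u.
  have /factor_theorem[u uE] : root (X1op p) b.
    by rewrite rootE /X1op !hE pexc; apply/eqP; field.
  by exists (- u); rewrite uE; ring.
exists u; split=> //.
have ub : u.[b] = (1 - b ^+ 2) * p^`()^`().[b].
  have := congr1 (fun q => q^`().[b]) uE.
  rewrite /X1op !dE !hE pexc => E.
  transitivity (- ((0 - 1) * u.[b] + (b - b) * u^`().[b])); first by ring.
  by rewrite -E; field.
have := congr1 (fun q => q^`()^`().[b]) uE.
rewrite ub /X1op !dE !hE pexc => E.
have -> : u^`().[b] = - (((0 - 0) * u.[b] + (0 - 1) * u^`().[b]) +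
     ((0 - 1) * u^`().[b] + (b - b) * u^`()^`().[b])) / 2 by field.
by rewrite -E; field.
Qed.

End X1JacobiOperator.

(** * Inequality between arithmetic and harmonic means *)

Section RecipSum.
Variable R : realFieldType.

(* The tangent line bound 1 / y >= 2 mu - mu ^ 2 y, summed with mu the inverse of
   the mean of the y's. *)
Lemma harmonic_arithmetic_mean (s : seq R) : (forall x, x \in s -> 0 < x) ->
  (size s)%:R ^+ 2 <= (\sum_(x <- s) x^-1) * \sum_(x <- s) x.
Proof.
move=> s0; have [->|sn0] := eqVneq s [::].
  by rewrite !big_nil mulr0 expr0n.
pose A := \sum_(x <- s) x; pose N := (size s)%:R : R.
have A0 : 0 < A.
  case: s s0 sn0 @A @N => // x s s0 _ A _; rewrite /A big_cons ltr_pwDl //.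
    by apply: s0; rewrite mem_head.
  by rewrite big_seq sumr_ge0 // => y ys; rewrite ltW // s0 // inE ys orbT.
rewrite -ler_pdivrMr //.
have : \sum_(x <- s) (2 * (N / A) - (N / A) ^+ 2 * x) <= \sum_(x <- s) x^-1.
  rewrite big_seq [leRHS]big_seq; apply: ler_sum => x /s0 x0.
  rewrite -subr_ge0.
  have -> : x^-1 - (2 * (N / A) - (N / A) ^+ 2 * x) = (1 - (N / A) * x) ^+ 2 / x.
    by field; rewrite !gt_eqF.
  by rewrite divr_ge0 ?sqr_ge0 // ltW.
apply: le_trans; rewrite big_split /= sumrN -!mulr_sumr big_const_seq count_predT.
rewrite iter_addr_0 -/A -mulr_natr -[(size s)%:R]/N.
rewrite le_eqVlt; apply/orP; left; apply/eqP.
by field; rewrite gt_eqF.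
Qed.

End RecipSum.

(** * Eigenvalue equation, sum of zeros and upper bound in the Jacobi case *)

Section X1JacobiBound.
Variables (R : realType) (a b : R) (D : interval R).
Hypothesis a_gt0 : 0 < a.
Hypothesis b_gt0 : 0 < b.
Hypothesis Db : forall x, x \in D -> 0 < a * (b - x).
Variable L : {poly R} -> R.
Hypothesis L_linear : forall k p q, L (k *: p + q) = k * L p + L q.
Hypothesis L_gt0 : forall g, g != 0 -> (forall x, x \in D -> 0 <= g.[x]) -> 0 < L g.
(** Symmetry of the operator T, stated without division: [u] and [w] are T p and T q. *)
Hypothesis L_sym : forall p q u w,
  X1op a b p = (b%:P - 'X) * u -> X1op a b q = (b%:P - 'X) * w ->
  L (u * q) = L (p * w).
Variables (ip : {poly R} -> {poly R} -> R) (v : nat -> {poly R}).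
Hypothesis ipE : forall p q, ip p q = L (p * q).
Hypothesis v_monic : forall n, (0 < n)%N -> v n \is monic.
Hypothesis size_v : forall n, (0 < n)%N -> size (v n) = n.+1.
Hypothesis v_exceptional : forall n, (0 < n)%N -> exceptional a b (v n).

Local Notation P := (gram_schmidt ip v).

Let a_neq0 : a != 0. Proof. by rewrite gt_eqF. Qed.

Lemma size_BsubX_M (u : {poly R}) : u != 0 -> size ((b%:P - 'X) * u) = (size u).+1.
Proof.
move=> u0; have -> : (b%:P - 'X) * u = - (('X - b%:P) * u) by ring.
by rewrite size_polyN size_monicM ?monicXsubC // size_XsubC.
Qed.

(** The remainder r = T P - l P is exceptional of lower degree than P, and so is T r. By symmetry L
    (r r) = L (P (T r)) - l L (P r) = 0, hence r = 0. *)
Lemma X1op_eigen m : X1op a b (P m.+2) =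
  (b%:P - 'X) * ((m.+1%:R * (m.+2%:R + 2 * a * b)) *: P m.+2).
Proof.
set l := (m.+1%:R * _).
have [Pm Ps Pexc _] := gram_schmidt_spec L_linear L_gt0 ipE v_monic size_v
  v_exceptional (ltn0Sn m.+1).
have orth := gram_schmidt_orthogonal a_neq0 L_linear L_gt0 ipE v_monic size_v
  v_exceptional (ltn0Sn m.+1).
have Plead : (P m.+2)`_m.+2 = 1 by move: Pm; rewrite monicE /lead_coef Ps => /eqP.
have [u [uexc uE]] := X1op_exceptional a_neq0 Pexc.
have su : (size u <= m.+3)%N.
  have [->|u0] := eqVneq u 0; first by rewrite size_poly0.
  have := @size_X1op _ a b (P m.+2); rewrite uE size_BsubX_M // Ps !ltnS.
  exact.
have ulead : u`_m.+2 = l.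
  have := @X1op_coef_succ _ a b (P m.+2) m; rewrite Ps leqnn => /(_ isT).
  rewrite uE Plead mulr1 mulrBl coefB coefCM coefXM /= nth_default // mulr0 sub0r.
  by move/oppr_inj.
pose r := u - l *: P m.+2.
have rexc : exceptional a b r by apply: exceptionalB => //; exact: exceptionalZ.
have sr : (size r <= m.+2)%N.
  apply/leq_sizeP => j; rewrite leq_eqVlt => /predU1P[<-|mj].
    by rewrite coefB coefZ Plead ulead mulr1 subrr.
  by rewrite coefB coefZ !nth_default ?Ps ?mulr0 ?subrr // (leq_trans su).
suff r0 : r = 0 by rewrite uE; congr (_ * _); apply/eqP; rewrite -subr_eq0; apply/eqP.
apply/eqP/negP => /negP r0.
have [w [wexc wE]] := X1op_exceptional a_neq0 rexc.
have sr1 : (1 < size r)%N.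
  rewrite ltnNge; apply/negP => r1; move: rexc r0.
  rewrite [r]size1_polyC // /exceptional derivC horner0 hornerC => /esym/eqP.
  by rewrite mulf_eq0 oppr_eq0 (negPf a_neq0) /= => /eqP ->; rewrite eqxx.
have sw : (size w <= m.+2)%N.
  have [->|w0] := eqVneq w 0; first by rewrite size_poly0.
  have := size_X1op a b sr1; rewrite wE size_BsubX_M // ltnS => /leq_trans.
  exact.
have := functional_sqr_gt0 L_gt0 r0.
have -> : r * r = (- l) *: (P m.+2 * r) + u * r.
  by rewrite {1}/r mulrBl -scalerAl scaleNr addrC.
by rewrite L_linear orth // (L_sym uE wE) orth // mulr0 addr0 ltxx.
Qed.

Lemma sum_zeros m s t : size s = m.+1 -> P m.+2 = rootprod s * ('X - t%:P) ->
  (\sum_(x <- s) x + t) * (m.+1%:R + a * b) = b * (m.+2%:R + a * b) + a * m.+1%:R.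
Proof.
move=> sm PE.
have [Pm Ps _ _] := gram_schmidt_spec L_linear L_gt0 ipE v_monic size_v
  v_exceptional (ltn0Sn m.+1).
have Plead : (P m.+2)`_m.+2 = 1 by move: Pm; rewrite monicE /lead_coef Ps => /eqP.
have Psub : (P m.+2)`_m.+1 = - (\sum_(x <- s) x + t).
  have -> : P m.+2 = rootprod (t :: s) by rewrite PE rootprod_cons mulrC.
  have := @coefPn_prod_XsubC R (t :: s); rewrite /= sm => /(_ isT) ->.
  by rewrite big_cons addrC.
have := @X1op_coef _ a b (P m.+2) m; rewrite Ps leqnn => /(_ isT).
rewrite X1op_eigen mulrBl coefB coefCM coefXM !coefZ /= Plead Psub => E.
(* The comparison of coefficients gives twice the claimed identity. *)
apply: (mulfI (_ : 2 != 0 :> R)) => //.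
set e := \sum_(x <- s) x + t in E *.
rewrite -[m.+2]addn2 -[m.+1]addn1 !natrD in E *.
move/eqP: E; rewrite -subr_eq0 => /eqP E; apply: subr0_eq; rewrite -E.
by field.
Qed.

(** With N = m + 1 and S the reciprocal sum, the claim amounts to b S >= N. The sum of the regular
    zeros itself involves the exceptional zero, so the mean inequality applies only implicitly and
    the proof goes by contradiction. *)
Lemma exc_root_bound m s : {subset s <= D} -> size s = m.+1 ->
  P m.+2 = rootprod s * ('X - (exc_root a b s)%:P) ->
  exc_root a b s <= b + b / (m.+1%:R + a * b).
Proof.
move=> sD sm PE; have := sum_zeros sm PE; rewrite /exc_root.
have S0 : 0 <= recip_sum b s.
  by have := recip_sum_ge0 Db sD; rewrite pmulr_rge0.
have : m.+1%:R ^+ 2 <= recip_sum b s * (m.+1%:R * b - \sum_(x <- s) x).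
  have := @harmonic_arithmetic_mean _ [seq b - x | x <- s].
  rewrite !big_map size_map sm sumrB big_const_seq count_predT sm iter_addr_0.
  rewrite -[b *+ _]mulr_natl; apply => _ /mapP[x /sD xD ->].
  by have := Db xD; rewrite pmulr_rgt0.
move: S0; set S := recip_sum b s; set sg := \sum_(x <- s) x.
rewrite -[m.+2]addn1 natrD; have : 1 <= m.+1%:R :> R by rewrite ler1n.
set N : R := m.+1%:R => N1 S0 jensen eN.
have K1 : 1 < N + a * b by have : 0 < a * b by [rewrite mulr_gt0]; lra.
move: eN; set K := N + a * b in K1 *; set c := (a + S)^-1 => eN.
have aS : a + S != 0 by rewrite gt_eqF // ltr_pwDl.
have c0 : 0 < c by rewrite invr_gt0 ltr_pwDl.
have cE : c * (a + S) = 1 by rewrite /c mulVf.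
rewrite lerD2l ler_pdivlMr ?(lt_trans ltr01) // leNgt; apply/negP => cK.
(* The defect [eps] is positive exactly when the claim fails. *)
pose eps := N - b * S.
have ceps : c * K - b = c * eps.
  by rewrite -[X in _ - X]mulr1 -cE /K /eps; ring.
have eps0 : 0 < eps by rewrite -(pmulr_rgt0 _ c0) -ceps subr_gt0.
have sgK : sg * K = a * N - c * eps by rewrite -ceps; move: eN; rewrite /K; lra.
have Neps : N * eps <= - (S * sg) by move: jensen; rewrite /eps; lra.
have cS : c * S <= 1 by rewrite -cE ler_wpM2l ?(ltW c0) // lerDr ltW.
(* The mean inequality times [K], with [sgK] substituted. Cancelling [eps] then gives N K <= c S <=
   1, against N >= 1 and K > 1. *)
have NKeps : N * K * eps <= c * S * eps.
  have : N * eps * K <= - (S * sg) * K by rewrite ler_pM2r // (lt_trans ltr01).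
  have -> : - (S * sg) * K = c * S * eps - S * a * N 
    by transitivity (- (S * (sg * K))); [ring|rewrite sgK; ring].
  have : 0 <= S * a * N by rewrite !mulr_ge0 ?(ltW a_gt0) // (le_trans ler01).
  lra.
have : N * K <= c * S by rewrite -(ler_pM2r eps0).
have : N * 1 < N * K by rewrite ltr_pM2l // (lt_le_trans ltr01).
lra.
Qed.

End X1JacobiBound.

(** * Integration of polynomials against a weight *)

Section WeightedIntegral.
Local Open Scope classical_set_scope.
Variables (R : realType) (D : interval R) (w : R -> R).
Local Notation mu := (@lebesgue_measure R).

Definition weighted_int (g : {poly R}) : R := \int[mu]_(x in [set` D]) (g.[x] * w x).

Hypothesis w_integrable : forall g : {poly R},
  mu.-integrable [set` D] (EFin \o (fun x => g.[x] * w x)).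

Lemma weighted_int_linear k p q :
  weighted_int (k *: p + q) = k * weighted_int p + weighted_int q.
Proof.
rewrite /weighted_int -RintegralZl // -RintegralD //.
  by apply: eq_Rintegral => x _; rewrite hornerD hornerZ mulrDl mulrA.
have := w_integrable (k *: p); congr (_.-integrable _ _).
by apply/funext => x /=; rewrite hornerZ mulrA.
Qed.

(** A nonnegative integrand with zero integral vanishes almost everywhere. Then [D] is covered by a
    null set, the finite list [Z] where the weight may vanish, and the finitely many roots of [g],
    against its positive measure. *)
Lemma weighted_int_gt0 (Z : seq R) (g : {poly R}) :
  mu [set` D] != 0%E ->
  (forall x, x \in D -> 0 <= w x) -> (forall x, x \in D -> x \notin Z -> 0 < w x) ->
  g != 0 -> (forall x, x \in D -> 0 <= g.[x]) -> 0 < weighted_int g.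
Proof.
move=> muD w0 wZ g0 gD; pose f x := g.[x] * w x.
have f0 x : x \in D -> 0 <= f x by move=> xD; rewrite mulr_ge0 ?gD ?w0.
have iD := w_integrable g.
rewrite lt_neqAle; apply/andP; split; last by apply: Rintegral_ge0 => x /f0.
apply/eqP => I0; move/eqP: muD; apply.
have absI0 : (\int[mu]_(x in [set` D]) `|(EFin \o f) x| = 0)%E.
  transitivity (\int[mu]_(x in [set` D]) (f x)%:E)%E.
    by apply: eq_integral => x; rewrite inE /= => /f0 fx; rewrite ger0_norm.
  rewrite -[LHS]fineK; first by rewrite [fine _](esym I0).
  exact: integrable_fin_num.
have mf := measurable_int _ iD.
have [H _] := ae_eq_integral_abs mu (measurable_itv D) mf.
have [N [mN N0 DN]] := H absI0.
apply/negligibleP; first exact: measurable_itv.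
have Fneg : mu.-negligible [set` Z ++ rootsR g].
  apply/negligibleP; first by apply: countable_measurable => //;
    apply: finite_set_countable; exact: finite_seq.
  by apply: countable_lebesgue_measure0; apply: finite_set_countable; exact: finite_seq.
have Nneg : mu.-negligible N by exists N; split.
apply: negligibleS (negligibleU Nneg Fneg) => x /= xD.
have [|xZ] := boolP (x \in Z ++ rootsR g); first by right.
left; apply: DN => /= /(_ xD)[] /eqP.
rewrite /cst mulf_eq0 => /orP[|wx0].
  have := roots_on_rootsR g0 x; rewrite in_itv /= rootE => gx.
  by move: xZ; rewrite mem_cat negb_or -gx => /andP[_ /negPf ->].
move: xZ; rewrite mem_cat negb_or => /andP[/(wZ _ xD)]; by rewrite (eqP wx0) ltxx.
Qed.

End WeightedIntegral.

(** * A continuous extension of the real power *)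

Section TruncatedPower.
Local Open Scope classical_set_scope.
Variable R : realType.
Implicit Types p x : R.

(* Coincides with the real power on [0, +oo[ for p > 0, and, unlike powR, which is
   constantly 1 on negative arguments, is continuous on the whole line. *)
Definition tpow p x : R := if 0 < x then x `^ p else 0.

Lemma tpowE p x : 0 < p -> 0 <= x -> tpow p x = x `^ p.
Proof.
rewrite /tpow le_eqVlt => p0 /predU1P[<-|-> //].
by rewrite ltxx powR0 // gt_eqF.
Qed.

Lemma tpow_gt0 p x : 0 < x -> 0 < tpow p x.
Proof. by rewrite /tpow => x0; rewrite x0 powR_gt0. Qed.

Lemma tpow_ge0 p x : 0 <= tpow p x.
Proof. by rewrite /tpow; case: ifP => // _; exact: powR_ge0. Qed.

Lemma tpow_succ p x : tpow (p + 1) x = x * tpow p x.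
Proof.
rewrite /tpow; case: ifP => [x0|_]; last by rewrite mulr0.
by rewrite powRD ?powRr1 1?mulrC // ?(ltW x0) // (gt_eqF x0) implybT.
Qed.

Lemma tpow0 p : tpow p 0 = 0.
Proof. by rewrite /tpow ltxx. Qed.

Lemma is_derive_tpow p x : 0 < x -> is_derive x 1 (tpow p) (p * tpow (p - 1) x).
Proof.
move=> x0; rewrite /tpow x0; have := is_derive1_powR p x0.
apply: near_eq_is_derive; near=> y; rewrite ifT //.
by near: y; exact: lt_nbhsr.
Unshelve. all: by end_near. Qed.

Lemma continuous_tpow p : 0 < p -> continuous (tpow p).
Proof.
move=> p0 x; have [x0|x0|->] := ltgtP x 0.
- apply: (@cvg_trans _ ((fun=> 0 : R) @ x)).
    by apply: near_eq_cvg; near=> y; rewrite /tpow lt_gtF //;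
       near: y; exact: lt_nbhsl.
  have -> : tpow p x = 0 by rewrite /tpow (lt_gtF x0).
  exact: (@cst_continuous R R 0 x).
- have [d _] := is_derive_tpow p x0.
  exact/differentiable_continuous/derivable1_diffP.
- apply/cvgrPdist_lt => e e0; rewrite tpow0.
  (* The radius e^(1/p) ensures y^p < e. *)
  have d0 : 0 < e `^ p^-1 by rewrite powR_gt0.
  near=> y; rewrite sub0r normrN ger0_norm ?tpow_ge0 //.
  rewrite /tpow; case: ifPn => // y0.
  have -> : e = (e `^ p^-1) `^ p by rewrite -powRrM mulVf ?gt_eqF // powRr1 ?ltW.
  apply: gt0_ltr_powR => //; rewrite ?nnegrE ?ltW //.
  by near: y; exact: lt_nbhsl.
Unshelve. all: by end_near. Qed.

End TruncatedPower.

(** * Jacobi weight: integrability, positivity and integration by parts *)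

Section JacobiWeight.
Local Open Scope classical_set_scope.
Variables (R : realType) (alpha beta b : R).
Hypothesis alpha_gt0 : 0 < alpha.
Hypothesis beta_gt0 : 0 < beta.
Hypothesis b_gt1 : 1 < b.
Local Notation mu := (@lebesgue_measure R).

Definition jacobi_weight x : R :=
  tpow alpha (1 - x) * tpow beta (1 + x) / (x - b) ^+ 2.

Local Notation L := (weighted_int `[-1, 1]%R jacobi_weight).

Let continuous_tpow_horner p (q : {poly R}) : 0 < p -> continuous (tpow p \o horner q).
Proof.
move=> p0 x; apply: continuous_comp; first exact: continuous_horner.
exact: continuous_tpow.
Qed.

Let continuous_jacobi_weight (g : {poly R}) :
  {within `[-1, 1], continuous (fun x => g.[x] * jacobi_weight x)}.
Proof.
apply: continuous_in_subspaceT => x; rewrite inE /= in_itv /= => /andP[_ x1].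
have -> : (fun x => g.[x] * jacobi_weight x) =
    (fun x => horner g x * (((tpow alpha \o horner (1%:P - 'X)) x
      * (tpow beta \o horner (1%:P + 'X)) x)
      * (horner (('X - b%:P) ^+ 2) x)^-1)).
  apply/funext => y; rewrite /jacobi_weight /=.
  by rewrite horner_exp !hornerD !hornerN !hornerX !hornerC.
apply: cvgM; first exact: continuous_horner.
apply: cvgM; last first.
  apply: cvgV; last exact: continuous_horner.
  rewrite horner_exp hornerXsubC expf_neq0 // subr_eq0 lt_eqF //.
  exact: le_lt_trans b_gt1.
by apply: cvgM; exact: continuous_tpow_horner.
Qed.

Lemma jacobi_weight_integrable (g : {poly R}) :
  mu.-integrable `[-1, 1] (EFin \o (fun x => g.[x] * jacobi_weight x)).
Proof.
apply: continuous_compact_integrable; first exact: segment_compact.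
exact: continuous_jacobi_weight.
Qed.

Lemma jacobi_functional_linear k p q : L (k *: p + q) = k * L p + L q.
Proof. exact/weighted_int_linear/jacobi_weight_integrable. Qed.

Lemma jacobi_weight_ge0 x : 0 <= jacobi_weight x.
Proof. by rewrite divr_ge0 ?sqr_ge0 // mulr_ge0 ?tpow_ge0. Qed.

Lemma jacobi_functional_gt0 g : g != 0 ->
  (forall x, x \in `[-1, 1]%R -> 0 <= g.[x]) -> 0 < L g.
Proof.
apply: (weighted_int_gt0 jacobi_weight_integrable (Z := [:: -1; 1])).
- rewrite lebesgue_measure_itv /= lte_fin ifT; last by lra.
  by rewrite -EFinB eqe; apply/eqP; lra.
- by move=> x _; exact: jacobi_weight_ge0.
- move=> x; rewrite in_itv /= !inE negb_or => /andP[x1 x2] /andP[x3 x4].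
  have x5 : -1 < x by rewrite lt_neqAle eq_sym x3.
  have x6 : x < 1 by rewrite lt_neqAle x4.
  apply: divr_gt0; first by rewrite mulr_gt0 // tpow_gt0 //; lra.
  by rewrite exprn_even_gt0 //= subr_eq0 lt_eqF // (lt_trans x6).
Qed.

(* g * jacobi_weight is the derivative of
   Q (1 - x) ^ (alpha + 1) (1 + x) ^ (beta + 1) / (x - b) ^ 2. *)
Lemma jacobi_functional_eq0 (g Q : {poly R}) :
  (forall x : R, x \in `]-1, 1[%R -> g.[x] * (x - b) =
     (Q^`().[x] * (1 - x ^+ 2)
      + Q.[x] * ((beta + 1) * (1 - x) - (alpha + 1) * (1 + x))) * (x - b)
     - 2 * Q.[x] * (1 - x ^+ 2)) ->
  L g = 0.
Proof.
move=> gQ; set B := ('X - b%:P) ^+ 2.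
pose F := (horner Q * (fun y => (horner B y)^-1)) *
   ((tpow (alpha + 1) \o horner (1%:P - 'X)) *
    (tpow (beta + 1) \o horner (1%:P + 'X))).
have B0 x : x <= 1 -> B.[x] != 0.
  move=> x1; rewrite horner_exp hornerXsubC expf_neq0 // subr_eq0 lt_eqF //.
  exact: le_lt_trans b_gt1.
have dF (x : R) : x \in `]-1, 1[%R -> is_derive x 1 F (g.[x] * jacobi_weight x).
  move=> xI; have := xI; rewrite in_itv /= => /andP[x1 x2].
  have y1 : 0 < (1%:P - 'X).[x] by rewrite hornerD hornerN hornerX hornerC; lra.
  have y2 : 0 < (1%:P + 'X).[x] by rewrite hornerD hornerX hornerC; lra.
  have d1 := @is_derive_poly _ Q x.
  have d2 := is_deriveV (B0 _ (ltW x2)) (@is_derive_poly _ B x).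
  have d3 := is_derive1_comp (is_derive_tpow (alpha + 1) y1) (@is_derive_poly _ _ x).
  have d4 := is_derive1_comp (is_derive_tpow (beta + 1) y2) (@is_derive_poly _ _ x).
  have d12 := is_deriveM d1 d2.
  have d34 := is_deriveM d3 d4.
  have d := is_deriveM d12 d34.
  apply: (is_derive_eq d).
  have xb : x - b != 0 by rewrite subr_eq0 lt_eqF // (lt_trans x2).
  apply: (mulIf xb); rewrite /jacobi_weight.
  rewrite [RHS]mulrAC gQ // /B !fctE /GRing.scale /= !addrK !tpow_succ.
  rewrite deriv_exp /= expr1 !derivD !derivN !derivX !derivC.
  rewrite !(hornerD, hornerN, hornerM, hornerX, hornerC, hornerMn, horner_exp).
  by field.
have cF (x : R) : x <= 1 -> {for x, continuous F}.
  move=> x1; apply: cvgM.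
    apply: cvgM; first exact: continuous_horner.
    by apply: cvgV; [exact: B0|exact: continuous_horner].
  by apply: cvgM; apply: continuous_tpow_horner; exact: ltr_pDl.
have F1 : F 1 = 0.
  rewrite /F !fctE /= hornerD hornerN hornerX hornerC subrr tpow0.
  by rewrite mul0r mulr0.
have FN1 : F (-1) = 0.
  rewrite /F !fctE /= !hornerD hornerX hornerC subrr tpow0.
  by rewrite !mulr0.
rewrite /weighted_int /Rintegral.
rewrite (@continuous_FTC2 _ _ F) ?F1 ?FN1 ?subee //.
- split.
  + by move=> x /dF[].
  + by apply: cvg_at_right_filter; apply: cF; lra.
  + by apply: cvg_at_left_filter; apply: cF; lra.
- by move=> x /dF[_ <-]; rewrite derive1E.
Qed.

End JacobiWeight.

(** Lagrange identity: the weight times (T p) q - p (T q) is an exact derivative, with the Wronskian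
    p q' - p' q as the polynomial factor [Q] of [jacobi_functional_eq0]. *)
Lemma jacobi_functional_sym (R : realType) (alpha beta a b : R) (p q u w : {poly R}) :
  0 < alpha -> 0 < beta -> 1 < b -> a != 0 ->
  alpha = a * (b - 1) -> beta = a * (b + 1) ->
  X1op a b p = (b%:P - 'X) * u -> X1op a b q = (b%:P - 'X) * w ->
  weighted_int `[-1, 1]%R (jacobi_weight alpha beta b) (u * q) =
  weighted_int `[-1, 1]%R (jacobi_weight alpha beta b) (p * w).
Proof.
move=> al0 be0 b1 a0 alE beE up wq.
set L := weighted_int _ _.
have L_lin := jacobi_functional_linear al0 be0 b1.
suff L0 : L (- 1 *: (p * w) + u * q) = 0.
  by move: L0; rewrite /L L_lin mulN1r => /eqP; rewrite addrC subr_eq0 => /eqP.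
apply: (@jacobi_functional_eq0 _ _ _ _ al0 be0 b1 _ (p * q^`() - p^`() * q)) => x _.
have pu : u.[x] * (x - b) = - (X1op a b p).[x].
  by rewrite up hornerM hornerD hornerN hornerX hornerC; ring.
have qw : w.[x] * (x - b) = - (X1op a b q).[x].
  by rewrite wq hornerM hornerD hornerN hornerX hornerC; ring.
transitivity ((u.[x] * (x - b)) * q.[x] - p.[x] * (w.[x] * (x - b))).
  by rewrite scaleN1r hornerD hornerN !hornerM; ring.
rewrite pu qw /X1op !(derivD, derivN, derivM).
rewrite !(hornerD, hornerN, hornerM, hornerX, hornerC) alE beE.
by field.
Qed.

(** * Laguerre weight: integrability and positivity *)

Section LaguerreWeight.
Local Open Scope classical_set_scope.
Variables (R : realType) (alpha : R).
Hypothesis alpha_gt0 : 0 < alpha.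
Local Notation mu := (@lebesgue_measure R).

Definition laguerre_weight x : R := expR (- x) * tpow alpha x / (x + alpha) ^+ 2.

Local Notation L := (weighted_int `[0, +oo[%R laguerre_weight).

Let continuous_laguerre_weight (g : {poly R}) :
  {within `[0, +oo[, continuous (fun x => g.[x] * laguerre_weight x)}.
Proof.
apply: continuous_in_subspaceT => x; rewrite inE /= in_itv /= andbT => x0.
have -> : (fun x => g.[x] * laguerre_weight x) =
    (fun x => horner g x * (((expR \o -%R) x * tpow alpha x)
      * (horner (('X + alpha%:P) ^+ 2) x)^-1)).
  apply/funext => y; rewrite /laguerre_weight /=.
  by rewrite horner_exp !hornerD !hornerX !hornerC.
apply: cvgM; first exact: continuous_horner.
apply: cvgM; last first.
  apply: cvgV; last exact: continuous_horner.
  by rewrite horner_exp hornerD hornerX hornerC expf_neq0 // gt_eqF // ltr_wpDl.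
apply: cvgM; last exact: continuous_tpow.
apply: continuous_comp; [exact: opp_continuous|exact: continuous_expR].
Qed.

Lemma horner_growth (g : {poly R}) : exists A d, 0 <= A /\
  forall x : R, 0 <= x -> `|g.[x]| <= A * (1 + x) ^+ d.
Proof.
elim/poly_ind: g => [|g c [A [d [A0 H]]]].
  by exists 0, 0%N; split=> // x _; rewrite horner0 normr0 mul0r.
exists (A + `|c|), d.+1; split=> [|x x0]; first by rewrite addr_ge0.
rewrite hornerMXaddC (le_trans (ler_normD _ _)) // mulrDl lerD //.
  rewrite normrM (ger0_norm x0) exprSr mulrA ler_pM ?H //.
  by rewrite lerDr.
by rewrite ler_peMr // exprn_ege1 // lerDl.
Qed.

(** This is 1 + y <= e^y at y = (1 + x) / (2 k), raised to the power k. *)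
Lemma exprn_le_expR k (x : R) : (0 < k)%N -> 0 <= x ->
  (1 + x) ^+ k <= (2 * k%:R) ^+ k * expR (2^-1) * expR (x / 2).
Proof.
move=> k0 x0; pose y := (1 + x) / (2 * k%:R).
have k0' : 0 < k%:R :> R by rewrite ltr0n.
have -> : 1 + x = 2 * k%:R * y by rewrite /y; field; rewrite gt_eqF.
rewrite exprMn -mulrA ler_wpM2l ?exprn_ge0 ?mulr_ge0 ?(ltW k0') //.
have y0 : 0 <= y by rewrite divr_ge0 ?addr_ge0 // mulr_ge0 // ltW.
have -> : expR 2^-1 * expR (x / 2) = expR y ^+ k.
  by rewrite -expRD -expRM_natl; congr expR; rewrite /y; field; rewrite gt_eqF.
rewrite lerXn2r ?nnegrE ?expR_ge0 //.
by rewrite (le_trans _ (expR_ge1Dx y)) // lerDr.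
Qed.

(** Half of the decay of e^(-x) absorbs the polynomial growth of [g] and the power of x; what
    remains is dominated by a multiple of the exponential density of rate 1/2. *)
Lemma laguerre_weight_integrable (g : {poly R}) :
  mu.-integrable `[0, +oo[ (EFin \o (fun x => g.[x] * laguerre_weight x)).
Proof.
have [A [d [A0 Ag]]] := horner_growth g.
(* The growth exponent of [g] plus an integer exceeding [alpha]. *)
pose k := (d + (Num.bound alpha).+1)%N.
pose C := A * ((2 * k%:R) ^+ k * expR (2^-1)) / alpha ^+ 2.
have C0 : 0 <= C.
  by rewrite divr_ge0 ?sqr_ge0 ?mulr_ge0 ?exprn_ge0 ?expR_ge0 ?mulr_ge0.
(* The factor 2 cancels the rate 1/2 in front of the density. *)
have bound (x : R) : 0 <= x ->
    `|g.[x] * laguerre_weight x| <= (2 * C) * (exponential_pdf 2^-1 x).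
  move=> x0; rewrite /laguerre_weight.
  have -> : exponential_pdf 2^-1 x = 2^-1 * expR (- 2^-1 * x).
    exact: exponential_pdfE.
  have xa : tpow alpha x <= (1 + x) ^+ (Num.bound alpha).+1.
    rewrite tpowE //; apply: (@le_trans _ _ ((1 + x) `^ alpha)).
      by apply: ge0_ler_powR; rewrite ?nnegrE ?addr_ge0 ?lerDr // ltW.
    rewrite -powR_mulrn ?addr_ge0 //; apply: ler_powR; first by rewrite lerDl.
    by rewrite ltW // (lt_trans (archi_boundP (ltW alpha_gt0))) // ltr_nat.
  have xd : ((x + alpha) ^+ 2)^-1 <= (alpha ^+ 2)^-1.
    rewrite lef_pV2 ?posrE ?exprn_gt0 ?ltr_wpDl // lerXn2r ?nnegrE ?lerDr //.
      exact: ltW.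
    by rewrite addr_ge0 // ltW.
  have w0 : 0 <= expR (- x) * tpow alpha x / (x + alpha) ^+ 2.
    by rewrite divr_ge0 ?sqr_ge0 // mulr_ge0 ?expR_ge0 ?tpow_ge0.
  rewrite normrM (ger0_norm w0).
  apply: (@le_trans _ _ ((A * (1 + x) ^+ d) *
      (expR (- x) * (1 + x) ^+ (Num.bound alpha).+1 / alpha ^+ 2))).
    apply: ler_pM => //; first exact: Ag.
    apply: ler_pM => //; rewrite ?invr_ge0 ?sqr_ge0 //.
      by rewrite mulr_ge0 ?expR_ge0 ?tpow_ge0.
    by rewrite ler_wpM2l ?expR_ge0.
  have -> : (A * (1 + x) ^+ d) *
      (expR (- x) * (1 + x) ^+ (Num.bound alpha).+1 / alpha ^+ 2) =
      A / alpha ^+ 2 * expR (- x) * (1 + x) ^+ k.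
    by rewrite /k exprD; ring.
  apply: (@le_trans _ _ (A / alpha ^+ 2 * expR (- x) *
      ((2 * k%:R) ^+ k * expR (2^-1) * expR (x / 2)))).
    rewrite ler_wpM2l ?exprn_le_expR // /k ?addnS //.
    by rewrite mulr_ge0 ?expR_ge0 // divr_ge0 ?sqr_ge0.
  have -> : expR (- 2^-1 * x) = expR (- x) * expR (x / 2).
    by rewrite -expRD; congr expR; field.
  rewrite le_eqVlt; apply/orP; left; apply/eqP; rewrite /C.
  by field; rewrite gt_eqF.
have iC : mu.-integrable `[0, +oo[
    (EFin \o (fun x => (2 * C) * exponential_pdf 2^-1 x)).
  have H : mu.-integrable `[0, +oo[ (EFin \o exponential_pdf (2^-1 : R)).
    by apply: (integrableS measurableT) => //; apply: integrable_exponential_pdf.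
  apply: (integrableZl (mu := mu) (D := `[0, +oo[) _ (2 * C) H).
  exact: measurable_itv.
apply: le_integrable iC => //.
  apply/measurable_realfun.measurable_EFinP.
  apply: measurable_realfun.subspace_continuous_measurable_fun.
    exact: measurable_itv.
  exact: continuous_laguerre_weight.
move=> x; rewrite /= in_itv /= andbT => x0; rewrite lee_fin.
by rewrite (le_trans (bound x x0)) // ler_norm.
Qed.

Lemma laguerre_functional_linear k p q : L (k *: p + q) = k * L p + L q.
Proof. exact/weighted_int_linear/laguerre_weight_integrable. Qed.

Lemma laguerre_functional_gt0 g : g != 0 ->
  (forall x, x \in `[0, +oo[%R -> 0 <= g.[x]) -> 0 < L g.
Proof.
apply: (weighted_int_gt0 laguerre_weight_integrable (Z := [:: 0])).
- by rewrite lebesgue_measure_itv /= ltry.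
- move=> x _; rewrite divr_ge0 ?sqr_ge0 // mulr_ge0 ?expR_ge0 ?tpow_ge0 //.
- move=> x; rewrite in_itv /= inE andbT => x1 x2.
  have x0 : 0 < x by rewrite lt_neqAle eq_sym x2.
  apply: divr_gt0; first by rewrite mulr_gt0 ?expR_gt0 ?tpow_gt0.
  by rewrite exprn_gt0 // addr_gt0.
Qed.

End LaguerreWeight.

(** * Application to the two families *)

Section X1Families.
Variable R : realType.

Lemma X1_basis_monic (c z : R) n : (0 < n)%N ->
  let q := if n == 1%N then 'X - c%:P else ('X - z%:P) ^+ n in
  q \is monic /\ size q = n.+1.
Proof.
case: eqVneq => [->|_] _ /=; first by rewrite monicXsubC size_XsubC.
by rewrite monic_exp ?monicXsubC // size_exp_XsubC.
Qed.

Lemma X1_basis_exceptional (a b c : R) n : (c - b) * a = 1 -> (0 < n)%N ->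
  exceptional a b (if n == 1%N then 'X - c%:P else ('X - b%:P) ^+ n).
Proof.
move=> ca n0; case: eqVneq => [_|n1]; first exact: exceptional_XsubC.
by apply: exceptional_XsubC_exp; rewrite ltn_neqAle eq_sym n1.
Qed.

Lemma X1_jacobi_zeros (alpha beta : R) : 0 < alpha -> alpha < beta ->
  let b := jacobi_b alpha beta in
  let c := jacobi_c alpha beta in
  let x n := kth_zero (X1_jacobi alpha beta n) n in
  [/\ forall n : nat, (1 <= n)%N -> b < x n /\ x n <= c,
      x 1%N = c,
      forall m n : nat, (1 <= m)%N -> (m < n)%N -> x n < x m
    & forall n : nat, (1 <= n)%N ->
        b < x n /\
        x n <= (2 * n%:R + alpha + beta) / (2 * n%:R - 2 + alpha + beta) * b].
Proof.
move=> al0 albe b c x.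
have be0 : 0 < beta by exact: lt_trans albe.
pose a := (beta - alpha) / 2.
have ba0 : beta - alpha != 0 by rewrite subr_eq0 gt_eqF.
have a_gt0 : 0 < a by rewrite divr_gt0 // subr_gt0.
have a0 : a != 0 by rewrite gt_eqF.
have b1 : 1 < b.
  by rewrite /b /jacobi_b ltr_pdivlMr ?subr_gt0 // mul1r; lra.
have b_gt0 : 0 < b by exact: lt_trans b1.
have alE : alpha = a * (b - 1) by rewrite /a /b /jacobi_b; field.
have beE : beta = a * (b + 1) by rewrite /a /b /jacobi_b; field.
have cb : c = b + a^-1 by rewrite /c /jacobi_c -/b /a; congr (_ + _); field.
have Db (y : R) : y \in `[-1, 1]%R -> 0 < a * (b - y).
  rewrite in_itv /= => /andP[_ y1].
  by rewrite mulr_gt0 // subr_gt0; exact: le_lt_trans b1.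
pose L := weighted_int `[-1, 1]%R (jacobi_weight alpha beta b).
have ipE p q : jacobi_inner alpha beta p q = L (p * q).
  apply: eq_Rintegral => y; rewrite inE /= in_itv /= => /andP[y1 y2].
  by rewrite hornerM /jacobi_weight !tpowE //; lra.
have L_lin : forall k p q, L (k *: p + q) = k * L p + L q.
  exact: jacobi_functional_linear.
have L_gt0 : forall g, g != 0 ->
    (forall y, y \in `[-1, 1]%R -> 0 <= g.[y]) -> 0 < L g.
  exact: jacobi_functional_gt0.
pose v n := if n == 1%N then 'X - c%:P else ('X - b%:P) ^+ n.
have v_monic n : (0 < n)%N -> v n \is monic by case/(X1_basis_monic c b).
have size_v n : (0 < n)%N -> size (v n) = n.+1 by case/(X1_basis_monic c b).
have v_exc n : (0 < n)%N -> exceptional a b (v n).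
  by apply: X1_basis_exceptional; rewrite cb; field.
have xE n s : (0 < n)%N -> uniq s -> {subset s <= `[-1, 1]%R} -> size s = n.-1 ->
    X1_jacobi alpha beta n = rootprod s * ('X - (exc_root a b s)%:P) ->
    x n = exc_root a b s.
  move=> n0 us sD sn PE; rewrite /x PE -(prednK n0) -sn kth_zero_largest //.
  move=> y /sD /Db yb; have := addr_gt0 (exc_root_gt a0 Db sD) yb.
  by rewrite -mulrDr pmulr_rgt0 // addrA subrK subr_gt0.
have [xb x1 xmono] := exc_zero_sequence a0 Db L_lin L_gt0 ipE v_monic size_v v_exc xE.
have xgt n : (0 < n)%N -> b < x n.
  by move=> /xb[+ _]; rewrite pmulr_rgt0 // subr_gt0.
split.
- move=> n n0; split; first exact: xgt.
  have [_] := xb n n0; rewrite -[leRHS](mulfV a0) ler_pM2l // => H.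
  by rewrite cb -lerBlDl.
- by rewrite x1 cb.
- by move=> m n m0 mn; have := xmono m n m0 mn; rewrite pmulr_rgt0 // subr_gt0.
move=> n n0; split; first exact: xgt.
have abE : a * b = (alpha + beta) / 2 by rewrite /a /b /jacobi_b; field.
(* For n = 1 the bound is an equality, its right side being [c]. For n = m + 2 it is
   [exc_root_bound] rewritten with 2 a b = alpha + beta. *)
case: n n0 => [|[|m]] // _.
  rewrite x1 le_eqVlt; apply/orP; left; apply/eqP.
  rewrite /a /b /jacobi_b; field.
  by rewrite ba0 gt_eqF; lra.
have [s [us sD sm PE]] := gram_schmidt_factor a0 Db L_lin L_gt0 ipE v_monic size_v
  v_exc (ltn0Sn m.+1).
rewrite (xE _ s) //.
apply: (le_trans (exc_root_bound a_gt0 b_gt0 Db L_lin L_gt0 _ ipE v_monic size_v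
  v_exc sD sm PE)).
  by move=> p q u w; exact: jacobi_functional_sym.
rewrite abE -[m.+2]addn1 natrD le_eqVlt; apply/orP; left; apply/eqP.
have : 1 <= m.+1%:R :> R by rewrite ler1n.
move: (m.+1%:R) => N N1; field.
by rewrite gt_eqF; lra.
Qed.

Lemma X1_laguerre_zeros (alpha : R) : 0 < alpha ->
  let x n := kth_zero (X1_laguerre alpha n) 1 in
  [/\ forall n : nat, (1 <= n)%N -> - alpha - 1 <= x n /\ x n < - alpha,
      x 1%N = - (alpha + 1)
    & forall m n : nat, (1 <= m)%N -> (m < n)%N -> x m < x n].
Proof.
move=> al0 x; pose a : R := -1; pose b := - alpha.
have a0 : a != 0 by rewrite oppr_eq0 oner_eq0.
have Db (y : R) : y \in `[0, +oo[%R -> 0 < a * (b - y).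
  by rewrite in_itv /= andbT /a /b => y0; lra.
pose L := weighted_int `[0, +oo[%R (laguerre_weight alpha).
have ipE p q : laguerre_inner alpha p q = L (p * q).
  apply: eq_Rintegral => y; rewrite inE /= in_itv /= andbT => y0.
  by rewrite hornerM /laguerre_weight !tpowE.
have L_lin : forall k p q, L (k *: p + q) = k * L p + L q.
  exact: laguerre_functional_linear.
have L_gt0 : forall g, g != 0 ->
    (forall y, y \in `[0, +oo[%R -> 0 <= g.[y]) -> 0 < L g.
  exact: laguerre_functional_gt0.
(* This is b + 1 / a for a = -1. *)
pose c := b - 1.
pose v n := if n == 1%N then 'X + (alpha + 1)%:P else ('X + alpha%:P) ^+ n.
have vE n : v n = if n == 1%N then 'X - c%:P else ('X - b%:P) ^+ n.
  have -> : c = - (alpha + 1) by rewrite /c /b opprD.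
  by rewrite /v /b !polyCN !opprK.
have v_monic n : (0 < n)%N -> v n \is monic by rewrite vE; case/(X1_basis_monic c b).
have size_v n : (0 < n)%N -> size (v n) = n.+1
  by rewrite vE; case/(X1_basis_monic c b).
have v_exc n : (0 < n)%N -> exceptional a b (v n).
  by rewrite vE; apply: X1_basis_exceptional; rewrite /c /a; ring.
have xE n s : (0 < n)%N -> uniq s -> {subset s <= `[0, +oo[%R} -> size s = n.-1 ->
    X1_laguerre alpha n = rootprod s * ('X - (exc_root a b s)%:P) ->
    x n = exc_root a b s.
  move=> n0 us sD sn PE; rewrite /x PE kth_zero_smallest //.
  by move=> y /sD /Db; have := exc_root_gt a0 Db sD; rewrite /a; lra.
have [xb x1 xmono] := exc_zero_sequence a0 Db L_lin L_gt0 ipE v_monic size_v v_exc xE.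
split.
- by move=> n /xb; rewrite /a /b => -[xb1 xb2]; split; lra.
- by rewrite x1 /a /b invrN1 opprD.
- by move=> m n m0 mn; have := xmono m n m0 mn; rewrite /a; lra.
Qed.

End X1Families.

Theorem theorem1 (R : realType) :
  (forall alpha beta : R, 0 < alpha -> alpha < beta ->
     let b := jacobi_b alpha beta in
     let c := jacobi_c alpha beta in
     let x n := kth_zero (X1_jacobi alpha beta n) n in
     [/\ forall n : nat, (1 <= n)%N -> b < x n /\ x n <= c,
         x 1%N = c,
         forall m n : nat, (1 <= m)%N -> (m < n)%N -> x n < x m
       & forall n : nat, (1 <= n)%N ->
           b < x n /\
           x n <= (2 * n%:R + alpha + beta) / (2 * n%:R - 2 + alpha + beta) * b])
  /\
  (forall alpha : R, 0 < alpha ->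
     let x n := kth_zero (X1_laguerre alpha n) 1 in
     [/\ forall n : nat, (1 <= n)%N -> - alpha - 1 <= x n /\ x n < - alpha,
         x 1%N = - (alpha + 1)
       & forall m n : nat, (1 <= m)%N -> (m < n)%N -> x m < x n]).
Proof.
split=> [alpha beta|alpha]; [exact: X1_jacobi_zeros|exact: X1_laguerre_zeros].
Qed.
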